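(* Let $G$ be a connected graph of order $n$ with $G\not\cong K_n$, with remoteness $\rho$ and largest distance eigenvalue $\partial_1$. Then $$\partial_1-\rho\ \ge\ \frac{n-1+\sqrt{(n-1)^2+8}}{2}-\frac{n}{n-1},$$ and equality holds if and only if $G\cong K_n-e$, where $K_n-e$ is the graph obtained from the complete graph $K_n$ by deleting one edge $e$.
   Context: All graphs are finite, simple and undirected. For a connected graph $G$ with vertex set $V(G)=\{v_1,\dots,v_n\}$, $d_G(u,v)$ is the length of a shortest path between $u$ and $v$. The transmission of $v\in V(G)$ is $Tr(v)=\sum_{u\in V(G)} d_G(u,v)$, and the remoteness of $G$ is $\rho=\max_{v\in V(G)} \frac{Tr(v)}{n-1}$. The distance matrix $D(G)$ is the $n\times n$ real symmetric matrix with $(i,j)$-entry $d_G(v_i,v_j)$; its eigenvalues are the distance eigenvalues of $G$, and $\partial_1$ denotes the largest one. $K_n$ is the complete graph on $n$ vertices. *)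

(* Defs.v *)
From mathcomp Require Import all_boot all_order all_algebra.
From mathcomp Require Import all_classical all_reals.

Set Implicit Arguments.
Unset Strict Implicit.
Unset Printing Implicit Defensive.

Import Order.TTheory GRing.Theory Num.Theory.

Local Open Scope classical_set_scope.
Local Open Scope ring_scope.

Definition simple_graph (T : finType) (e : rel T) : Prop :=
  symmetric e /\ irreflexive e.

Definition connected_graph (T : finType) (e : rel T) : Prop :=
  forall x y : T, connect e x y.

Definition graph_iso (T U : finType) (e : rel T) (f : rel U) : Prop :=
  exists2 h : T -> U, bijective h & forall x y : T, f (h x) (h y) = e x y.

Definition complete_graph (n : nat) : rel 'I_n := [rel i j | i != j].

Definition delete_edge (T : finType) (e : rel T) (a b : T) : rel T :=
  [rel x y | e x y && ([set x; y]%SET != [set a; b]%SET)].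

Definition has_path (T : finType) (e : rel T) (k : nat) (x y : T) : bool :=
  [exists p : k.-tuple T, [&& path e x p, uniq (x :: p) & last x p == y]].

(* A path on distinct vertices has fewer than #|T| edges, so the range
   [k < #|T|] loses none; the value #|T| is only taken when no path joins x
   and y. *)
Definition graph_dist (T : finType) (e : rel T) (x y : T) : nat :=
  \big[Order.min/#|T|]_(k < #|T| | has_path e k x y) (k : nat).

Definition transmission (T : finType) (e : rel T) (v : T) : nat :=
  (\sum_(u : T) graph_dist e u v)%N.

(* The default 0 is harmless for the maximum of nonnegative numbers. *)
Definition remoteness (R : realType) (T : finType) (e : rel T) : R :=
  \big[Num.max/0]_(v : T) ((transmission e v)%:R / (#|T|%:R - 1)).

Definition distance_matrix (R : realType) (T : finType) (e : rel T) :
    'M[R]_#|T| :=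
  \matrix_(i, j) (graph_dist e (enum_val i) (enum_val j))%:R.

(* The eigenvalues form a finite set, nonempty when A is symmetric of positive
   size, so that the supremum is then a maximum. *)
Definition largest_eigenvalue (R : realType) (n : nat) (A : 'M[R]_n) : R :=
  sup [set l : R | eigenvalue A l].

(* Main.v *)
Require Import Defs.
From mathcomp Require Import all_boot all_order all_algebra.
From mathcomp Require Import all_classical all_reals.
From mathcomp Require Import spectral complex.
From mathcomp Require Import ring lra.

(** Let theta be the larger root of X^2 = (n - 1) X + 2; it is the largest
    distance eigenvalue of K_n - e, whose remoteness is n / (n - 1). The claim
    is therefore that the largest distance eigenvalue of G exceeds theta by at
    least (Tr(a) - n) / (n - 1), where [a] is a vertex of largest transmission.

    As G is not complete, some vertex has transmission at least n, hence so has
    [a], and thus [a] is nonadjacent to some [b]. Write D = D0 + E, where D is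
    the distance matrix of G and D0 that of the complete graph without [ab]; E
    is entrywise nonnegative ([delete_edge_dist_le]), and its row [a] has sum
    s = Tr(a) - n ([sum_delete_edge_dist]). The Perron vector x of D0 has the
    entry 1 + 1/theta at [a] and [b] and the entry 1 elsewhere
    ([edge_weight_eigen]). By the Rayleigh inequality
    ([rayleigh_le_largest_eigenvalue]) the largest eigenvalue of D is at least
    theta + (x E x^T) / |x|^2, and row and column [a] alone give
    x E x^T >= 2 (1 + 1/theta) s ([double_row_sum_le_form]). Finally
    2 (1 + 1/theta) (n - 1) > |x|^2 for n >= 3, which yields the bound.

    This last inequality is strict, so equality forces s = 0 and then
    x E x^T = 0; since x is positive, E = 0, and G is the complete graph without
    [ab]. Conversely, for that graph the positive eigenvector x of D0 shows that
    no eigenvalue is larger than theta ([norm_eigenvalue_le]), while the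
    remoteness is at least n / (n - 1). *)

Import Order.TTheory GRing.Theory Num.Theory.

Local Open Scope ring_scope.

(** * Eigenvalues of real symmetric matrices *)

(** Compare an eigenvector [v] with the positive vector [x] at an index where
    [`|v i| / x i] is largest. With [x] a Perron vector this shows that its
    eigenvalue is the largest one. *)
Lemma norm_eigenvalue_le (R : realFieldType) (n : nat) (A : 'M[R]_n)
    (x : 'I_n -> R) (c l : R) :
  (forall i, 0 < x i) -> (forall j, \sum_i x i * `|A i j| <= c * x j) ->
  eigenvalue A l -> `|l| <= c.
Proof.
move=> x_gt0 Ax_le /eigenvalueP[v vA /eqP v_neq0].
have [i0 vi0] : exists i, v 0 i != 0.
  by apply/existsP; apply: contra_notT v_neq0 => /existsPn v0;
     apply/rowP => i; rewrite mxE; apply/eqP; rewrite -[_ == _]negbK v0.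
have [j _ jmax] := @arg_maxP _ _ _ i0 xpredT (fun i => `|v 0 i| / x i) isT.
have {i0 vi0} vj_gt0 : 0 < `|v 0 j|.
  rewrite -(@pmulr_lgt0 _ (x j)^-1) ?invr_gt0//.
  apply: lt_le_trans (jmax i0 isT).
  by rewrite divr_gt0 ?normr_gt0.
rewrite -(ler_pM2r vj_gt0) -normrM.
have -> : l * v 0 j = \sum_i v 0 i * A i j.
  by have /rowP/(_ j) := vA; rewrite !mxE.
apply: le_trans (ler_norm_sum _ _ _) _.
have -> : c * `|v 0 j| = `|v 0 j| / x j * (c * x j).
  by field; rewrite gt_eqF.
apply: le_trans (ler_wpM2l _ (Ax_le j)); last by rewrite divr_ge0 ?ltW.
rewrite mulr_sumr; apply: ler_sum => i _.
rewrite normrM mulrA ler_wpM2r//.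
by rewrite -ler_pdivrMr//; apply: jmax.
Qed.

(** Makes the supremum in [largest_eigenvalue] an upper bound. *)
Lemma eigenvalue_ubound (R : realType) (n : nat) (A : 'M[R]_n) :
  has_ubound [set l : R | eigenvalue A l]%classic.
Proof.
exists (\sum_j \sum_i `|A i j|) => l /= /norm_eigenvalue_le lA.
apply: le_trans (ler_norm l) _; apply: (lA (fun=> 1)) => // j.
rewrite mulr1 [leRHS](bigD1 j)//=.
under [leLHS]eq_bigr do rewrite mul1r.
by rewrite lerDl; apply: sumr_ge0 => k _; apply: sumr_ge0.
Qed.

(** Diagonalise [A] over the complex numbers by a unitary matrix [P]: the
    diagonal entries are real, hence eigenvalues of [A] itself, and in the
    coordinates [w] of [v] both forms become weighted sums of [`|w i|^2]. *)
Lemma rayleigh_le_largest_eigenvalue (R : realType) (n : nat) (A : 'M[R]_n)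
    (v : 'rV[R]_n) :
  A^T = A ->
  (v *m A *m v^T) 0 0 <= largest_eigenvalue A * (v *m v^T) 0 0.
Proof.
move=> symA.
pose toC := real_complex R; pose C : numClosedFieldType := R[i].
pose B : 'M[C]_n := map_mx toC A.
have toC_real (r : R) : toC r \is Num.real by apply/complex_realP; exists r.
have BT : B^T = B by rewrite /B map_trmx symA.
have B_herm : B \is hermsymmx.
  apply: realsym_hermsym; last by apply/mxOverP => i j; rewrite mxE toC_real.
  by apply/is_hermitianmxP; rewrite expr0 scale1r map_mx_id.
have /orthomx_spectralP B_spec := hermitian_normalmx B_herm.
have sp_real := hermitian_spectral_diag_real B_herm.
move: B_spec sp_real (spectral_unitarymx B).
set P := spectralmx B; set sp := spectral_diag B => B_spec sp_real P_unitary.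
have sp_le i : sp 0 i <= toC (largest_eigenvalue A).
  have /complex_realP[l spi] : sp 0 i \is Num.real by apply/mxOverP.
  rewrite spi lecR; apply: (ub_le_sup (@eigenvalue_ubound _ _ A)) => /=.
  rewrite -(eigenvalue_map toC) -/B; apply/eigenvalueP; exists (row i P).
    (* [P *m B = diag_mx sp *m P]: the rows of [P] are eigenvectors. *)
    rewrite -row_mul B_spec !mulmxA mulmxV ?unitarymx_unit// mul1mx.
    by rewrite row_mul row_diag_mx -scalemxAl -rowE spi.
  apply: contraTneq P_unitary => Pi0; apply/negP => /unitarymxP/matrixP/(_ i i).
  rewrite !mxE eqxx big1 => [/eqP|j _]; first by rewrite eq_sym oner_eq0.
  by have /rowP/(_ j) := Pi0; rewrite !mxE => ->; rewrite mul0r.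
pose w := map_mx toC v *m P^t*%sesqui.
have ww (d : 'rV[C]_n) :
    (w *m diag_mx d *m w^t*%sesqui) 0 0 = \sum_i d 0 i * `|w 0 i| ^+ 2.
  rewrite mxE; apply: eq_bigr => i _.
  by rewrite mul_mx_diag !mxE normCK; ring.
have wE : w^t*%sesqui = P *m map_mx toC v^T.
  rewrite /w trmx_mul map_mxM trmxCK; congr (_ *m _).
  by apply/matrixP => i j; rewrite !mxE; apply/CrealP/toC_real.
have toC_le (r s : R) : (toC r <= toC s) = (r <= s) by rewrite lecR.
have toCM (r s : R) : toC (r * s) = toC r * toC s.
  exact: rmorphM (real_complex R) r s.
rewrite -toC_le toCM.
have -> : toC ((v *m A *m v^T) 0 0) = \sum_i sp 0 i * `|w 0 i| ^+ 2.
  rewrite -ww wE /w !mulmxA -(invmx_unitary P_unitary).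
  rewrite -!mulmxA (mulmxA (diag_mx sp)) (mulmxA (invmx P)) (mulmxA (invmx P)).
  by rewrite -B_spec -!map_mxM [RHS]mxE.
have -> : toC ((v *m v^T) 0 0) = \sum_i `|w 0 i| ^+ 2.
  transitivity (\sum_i (const_mx 1 : 'rV[C]_n) 0 i * `|w 0 i| ^+ 2); last first.
    by apply: eq_bigr => i _; rewrite mxE mul1r.
  rewrite -ww wE diag_const_mx mulmx1 /w -(invmx_unitary P_unitary).
  by rewrite -mulmxA mulKmx ?unitarymx_unit// -map_mxM [RHS]mxE.
rewrite mulr_sumr; apply: ler_sum => i _.
by rewrite ler_wpM2r// exprn_ge0.
Qed.

(** * Distances in graphs *)

Lemma graph_dist_le (T : finType) (e : rel T) (x : T) (p : seq T) :
  path e x p -> uniq (x :: p) -> (graph_dist e x (last x p) <= size p)%N.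
Proof.
move=> ep up; have p_lt : (size p < #|T|)%N.
  by rewrite -[X in (X <= _)%N]/(size (x :: p)) -(card_uniqP up) max_card.
apply: (@bigmin_le_cond _ _ _ #|T| (Ordinal p_lt)).
by apply/existsP; exists (in_tuple p); apply/and3P.
Qed.

Lemma le_graph_dist (T : finType) (e : rel T) (x y : T) (m : nat) :
  (m <= #|T|)%N ->
  (forall p, path e x p -> last x p = y -> (m <= size p)%N) ->
  (m <= graph_dist e x y)%N.
Proof.
move=> mT m_le; rewrite -leEnat; apply/bigmin_geP; split=> // k.
move=> /existsP[p /and3P[ep _ /eqP py]].
by rewrite -(size_tuple p); apply: m_le.
Qed.

Lemma graph_distC (T : finType) (e : rel T) (x y : T) :
  symmetric e -> graph_dist e x y = graph_dist e y x.
Proof.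
move=> e_sym; apply: eq_bigl => k.
suff half u v : has_path e k u v -> has_path e k v u.
  by apply/idP/idP; apply: half.
move=> /existsP[p /and3P[ep up /eqP <-]].
have sp : size (rev (belast u p)) == k.
  by rewrite size_rev size_belast size_tuple.
apply/existsP; exists (Tuple sp); apply/and3P; split=> /=.
- by rewrite rev_path (eq_path (e' := e)).
- by rewrite -[_ && _]/(uniq (_ :: _)) -rev_rcons -lastI rev_uniq.
- by case: (val p) => //= z s; rewrite rev_cons last_rcons.
Qed.

Lemma graph_distxx (T : finType) (e : rel T) (x : T) : graph_dist e x x = 0%N.
Proof. by apply/eqP; rewrite -leqn0; apply: (@graph_dist_le _ e x [::]). Qed.

Lemma graph_dist_adj (T : finType) (e : rel T) (x y : T) :
  irreflexive e -> e x y -> (graph_dist e x y <= 1)%N.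
Proof.
move=> e_irr exy; apply: (@graph_dist_le _ e x [:: y]); rewrite /= ?exy//.
by rewrite inE andbT; apply: contraTneq exy => ->; rewrite e_irr.
Qed.

Lemma graph_dist_common_neighbour (T : finType) (e : rel T) (x z y : T) :
  irreflexive e -> x != y -> e x z -> e z y -> (graph_dist e x y <= 2)%N.
Proof.
move=> e_irr xy exz ezy; apply: (@graph_dist_le _ e x [:: z; y]) => /=.
  by rewrite exz ezy.
rewrite !inE negb_or xy !andbT.
apply/andP; split; first by apply: contraTneq exz => ->; rewrite e_irr.
by apply: contraTneq ezy => ->; rewrite e_irr.
Qed.

Lemma transmission_lt_card (T : finType) (e : rel T) (a : T) :
  irreflexive e -> (forall u, u != a -> e u a) -> (transmission e a < #|T|)%N.
Proof.
move=> e_irr adj_a; rewrite -sum1_card /transmission (bigD1 a)//=.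
rewrite [ltnRHS](bigD1 a)//= graph_distxx add0n ltnS; apply: leq_sum => u ua.
by apply: graph_dist_adj => //; apply: adj_a.
Qed.

(** The default 0 of the maximum is never above the other terms, since
    transmissions are nonnegative; so remoteness is attained. *)
Lemma remotenessE (R : realType) (T : finType) (e : rel T) (v0 : T) :
  exists2 a : T, forall v, (transmission e v <= transmission e a)%N
    & remoteness R e = (transmission e a)%:R / (#|T|%:R - 1).
Proof.
have [a _ amax] := @arg_maxnP _ v0 xpredT (transmission e) isT.
have N_ge1 : 0 <= #|T|%:R - 1 :> R.
  by rewrite subr_ge0 (ler_nat R 1); apply/card_gt0P; exists v0.
exists a => [v|]; first exact: amax.
apply/eqP; rewrite eq_le; apply/andP; split; last exact: le_bigmax.
apply: bigmax_le => [|v _]; first by rewrite divr_ge0.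
by rewrite ler_wpM2r ?invr_ge0 ?ler_nat//; apply: amax.
Qed.

Lemma exists_neighbour (T : finType) (e : rel T) (a b : T) :
  connect e a b -> a != b -> exists c, e a c.
Proof.
move=> /connectP[[|c p] /= ep bE]; first by rewrite bE eqxx.
by exists c; case/andP: ep.
Qed.

Lemma exists_nonadjacent (T : finType) (e : rel T) (n : nat) :
  irreflexive e -> #|T| = n -> ~ graph_iso e (@complete_graph n) ->
  exists a b : T, a != b /\ ~~ e a b.
Proof.
move=> e_irr card_T e_ncomp.
have [/existsP[a /existsP[b /andP[ab eab]]]|] :=
  boolP [exists a, exists b, (a != b) && ~~ e a b]; first by exists a, b.
move=> all_adj; case: e_ncomp; subst n; exists enum_rank => [|x y].
  exact: enum_rank_bij.
rewrite /complete_graph /= (inj_eq enum_rank_inj).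
case: eqVneq => [->|xy] /=; first by rewrite e_irr.
apply/esym; apply: contraNT all_adj => exy.
by apply/existsP; exists x; apply/existsP; exists y; rewrite xy.
Qed.

Lemma card_ge3_of_nonadjacent (T : finType) (e : rel T) (a b : T) :
  irreflexive e -> connected_graph e -> a != b -> ~~ e a b -> (2 < #|T|)%N.
Proof.
move=> e_irr e_conn ab eab.
have [c eac] := @exists_neighbour _ _ a b (e_conn a b) ab.
have <- : #|[:: a; b; c]| = 3%N; last exact: max_card.
apply/card_uniqP; rewrite /= !inE negb_or ab /= andbT.
apply/andP; split; first by apply: contraTneq eac => <-; rewrite e_irr.
by apply: contraNneq eab => ->.
Qed.

(** * The metric of the complete graph without one edge *)

(** The metric of the complete graph on [T] without the edge [ab], in closed
    form for at least three vertices: deleting [ab] raises the distance of its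
    ends from 1 to 2. *)
Definition delete_edge_dist (T : finType) (a b u v : T) : nat :=
  (u != v) + ((u == a) && (v == b)) + ((u == b) && (v == a)).
Arguments delete_edge_dist {T}.

Lemma delete_edge_distC (T : finType) (a b u v : T) :
  delete_edge_dist a b u v = delete_edge_dist a b v u.
Proof.
rewrite /delete_edge_dist (eq_sym u v) (andbC (v == a)) (andbC (v == b)).
by rewrite -!addnA [((u == b) && _ + _)%N]addnC.
Qed.

Lemma delete_edge_dist_pair (T : finType) (a b : T) :
  a != b -> delete_edge_dist a b a b = 2%N.
Proof. by move=> ab; rewrite /delete_edge_dist !eqxx ab (negPf ab). Qed.

Lemma sum_delete_edge_dist (R : pzRingType) (T : finType) (a b : T) :
  a != b -> \sum_u (delete_edge_dist a b u a)%:R = #|T|%:R :> R.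
Proof.
move=> ab; rewrite -natr_sum; congr _%:R.
under eq_bigr => u _.
  rewrite /delete_edge_dist (negPf ab) andbF eqxx andbT addn0.
  over.
rewrite big_split /= -sum1_card (bigD1 a)//= eqxx add0n.
rewrite [in RHS](bigD1 a)//= addnC.
rewrite (bigD1 b)//= eqxx big1 ?addn0 => [|u /negPf -> //].
by congr (_ + _)%N; apply: eq_bigr => u ->.
Qed.

(** In a simple graph, distinct vertices have distance at least 1, and
    nonadjacent ones at least 2: as soon as [ab] is missing, the metric
    dominates that of K_n - ab entrywise. *)
Lemma delete_edge_dist_le (T : finType) (e : rel T) (a b u v : T) :
  simple_graph e -> a != b -> ~~ e a b ->
  (delete_edge_dist a b u v <= graph_dist e u v)%N.
Proof.
move=> [e_sym e_irr] ab eab; rewrite /delete_edge_dist.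
have cardT : (2 <= #|T|)%N.
  by have := max_card [set a; b]%SET; rewrite cards2 ab.
have [<-|uv] /= := eqVneq u v.
  by case: eqVneq => [->|]; rewrite ?(negPf ab) // andbF.
have dist2 : ~~ e u v -> (2 <= graph_dist e u v)%N.
  move=> euv; apply: le_graph_dist => // -[|z [|z' p]] //=.
    by move=> _ /eqP; rewrite (negPf uv).
  by rewrite andbT => euz zv; rewrite -zv euz in euv.
have dist1 : (1 <= graph_dist e u v)%N.
  apply: le_graph_dist => [|[|//] _ /= /eqP]; first exact: ltnW.
  by rewrite (negPf uv).
case: (eqVneq u a) => [ua|_] /=; case: (eqVneq v b) => [vb|_] /=.
- subst u v; rewrite (negPf ab); exact: dist2.
- by subst u; rewrite (negPf ab).
- by subst v; rewrite (eq_sym b a) (negPf ab) andbF.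
case: (eqVneq u b) => [ub|_] //=; case: (eqVneq v a) => [va|_] //=.
by subst u v; apply: dist2; rewrite e_sym.
Qed.

Lemma card_le_transmission (T : finType) (e : rel T) (a b : T) :
  simple_graph e -> a != b -> ~~ e a b -> (#|T| <= transmission e a)%N.
Proof.
move=> e_simple ab eab; rewrite -(ler_nat rat).
rewrite -(sum_delete_edge_dist _ _ _ _ ab).
by rewrite natr_sum; apply: ler_sum => u _; rewrite ler_nat delete_edge_dist_le.
Qed.

(** Adjacency in the complete graph on [T] without the edge [ab]. Saying it on
    [T] itself keeps the isomorphism out of the metric argument. *)
Definition misses_only (T : finType) (e : rel T) (a b : T) : Prop :=
  forall u v, e u v
    = (u != v) && ~~ ((u == a) && (v == b) || (u == b) && (v == a)).
Arguments misses_only {T}.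

Lemma set2_eq (T : finType) (x y a b : T) :
  ([set x; y]%SET == [set a; b]%SET)
    = (x == a) && (y == b) || (x == b) && (y == a).
Proof.
apply/eqP/orP => [xyab|[]/andP[/eqP-> /eqP->]//]; last by rewrite finset.setUC.
have := set21 x y; have := set22 x y; rewrite xyab !inE.
have := set21 a b; have := set22 a b; rewrite -xyab !inE.
by do 4![move/orP => [] /eqP ?]; subst; rewrite ?eqxx; auto.
Qed.

Lemma iso_delete_edge_completeP (T : finType) (e : rel T) (n : nat) :
  #|T| = n ->
  (exists a b : 'I_n, a != b /\
     graph_iso e (delete_edge (@complete_graph n) a b)) <->
  (exists a b : T, a != b /\ misses_only e a b).
Proof.
move=> card_T; split=> [[a [b [ab [h h_bij he]]]]|[a [b [ab eE]]]].
  have [g hK gK] := h_bij; exists (g a), (g b); split.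
    by rewrite (inj_eq (can_inj gK)).
  move=> u v; rewrite -he /delete_edge /complete_graph /= set2_eq.
  by rewrite (inj_eq (can_inj hK)) !(can2_eq hK gK).
subst n; exists (enum_rank a), (enum_rank b); split.
  by rewrite (inj_eq enum_rank_inj).
exists enum_rank => [|u v]; first exact: enum_rank_bij.
by rewrite /delete_edge /complete_graph /= set2_eq !(inj_eq enum_rank_inj) eE.
Qed.

(** Adjacency is read off the metric: for distinct [u], [v] it means distance
    at most 1, by [delete_edge_dist_le] applied to the pair [uv]. *)
Lemma misses_only_of_dist (T : finType) (e : rel T) (a b : T) :
  simple_graph e -> a != b ->
  (forall u v, graph_dist e u v = delete_edge_dist a b u v) ->
  misses_only e a b.
Proof.
move=> e_simple ab distE u v; have [_ e_irr] := e_simple.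
have [->|uv] /= := eqVneq u v; first by rewrite e_irr.
have [euv|euv] := boolP (e u v).
  have := graph_dist_adj _ _ _ _ e_irr euv; rewrite distE.
  by rewrite /delete_edge_dist uv; case: andP; case: andP.
have := @delete_edge_dist_le _ e u v u v e_simple uv euv.
rewrite delete_edge_dist_pair// distE /delete_edge_dist uv.
by case: andP; case: andP.
Qed.

(** The ends of the missing edge have a common neighbour: [a] has a neighbour
    by connectedness, and any vertex outside [{a, b}] is adjacent to [b]. *)
Lemma dist_le_of_misses_only (T : finType) (e : rel T) (a b u v : T) :
  simple_graph e -> connected_graph e -> a != b -> misses_only e a b ->
  (graph_dist e u v <= delete_edge_dist a b u v)%N.
Proof.
move=> [e_sym e_irr] e_conn ab eE.
have dist_ab : (graph_dist e a b <= 2)%N.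
  have [c eac] := @exists_neighbour _ _ a b (e_conn a b) ab.
  apply: (@graph_dist_common_neighbour _ _ a c b) => //.
  move: eac; rewrite !eE !eqxx (negPf ab) (eq_sym b a) (negPf ab) /=.
  rewrite andbF !orbF.
  by case/andP => ac cb; rewrite cb eq_sym (negPf ac).
have [->|uv] := eqVneq u v; first by rewrite graph_distxx.
have [euv|] := boolP (e u v).
  apply: leq_trans (graph_dist_adj _ _ _ _ e_irr euv) _.
  by rewrite /delete_edge_dist uv -!addnA.
rewrite eE uv /= negbK => /orP[]/andP[/eqP-> /eqP->].
  by rewrite delete_edge_dist_pair.
by rewrite graph_distC// delete_edge_distC delete_edge_dist_pair.
Qed.

(** * Distance eigenvalues *)

Lemma sum_enum_val (R : nmodType) (T : finType) (F : T -> R) :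
  \sum_(i < #|T|) F (enum_val i) = \sum_u F u.
Proof. by rewrite [RHS](reindex _ (onW_bij _ (enum_val_bij T))). Qed.

(** The hypothesis [0 <= c] covers a matrix without eigenvalues, for which
    the supremum is 0. *)
Lemma largest_eigenvalue_le (R : realType) (T : finType) (e : rel T)
    (x : T -> R) (c : R) :
  0 <= c -> (forall u, 0 < x u) ->
  (forall v, \sum_u x u * (graph_dist e u v)%:R <= c * x v) ->
  largest_eigenvalue (distance_matrix R e) <= c.
Proof.
move=> c_ge0 x_gt0 Dx_le; rewrite /largest_eigenvalue.
set S := (X in sup X); have [->|S_neq0] := eqVneq S set0.
  by rewrite sup0.
apply: ge_sup; first exact/set0P.
move=> l /= /norm_eigenvalue_le lD; apply: le_trans (ler_norm l) _.
apply: (lD (x \o enum_val)) => [i|j] /=; first exact: x_gt0.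
apply: le_trans (Dx_le (enum_val j)); rewrite -[leRHS]sum_enum_val.
by apply: ler_sum => i _; rewrite mxE ger0_norm.
Qed.

Lemma distance_rayleigh_le (R : realType) (T : finType) (e : rel T)
    (x : T -> R) :
  symmetric e ->
  \sum_v (\sum_u x u * (graph_dist e u v)%:R) * x v
    <= largest_eigenvalue (distance_matrix R e) * \sum_v x v ^+ 2.
Proof.
move=> e_sym; pose w : 'rV[R]_#|T| := \row_i x (enum_val i).
have symD : (distance_matrix R e)^T = distance_matrix R e.
  by apply/matrixP => i j; rewrite !mxE graph_distC.
move: (@rayleigh_le_largest_eigenvalue _ _ _ w symD); rewrite !mxE.
congr (_ <= _ * _); rewrite -[RHS]sum_enum_val; apply: eq_bigr => j _.
  rewrite !mxE -[in RHS]sum_enum_val; congr (_ * _).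
  by apply: eq_bigr => i _; rewrite !mxE.
by rewrite !mxE.
Qed.

(** * The Perron vector of the complete graph without one edge *)

Lemma sum_indicator (R : pzSemiRingType) (T : finType) (F : T -> R) (w : T) :
  \sum_u F u * (u == w)%:R = F w.
Proof.
rewrite (bigD1 w)//= eqxx mulr1 big1 ?addr0// => u /negPf ->.
by rewrite mulr0.
Qed.

(** For [t = theta^-1] this is the Perron vector of the distance matrix of
    K_n - ab; see [edge_weight_eigen]. *)
Definition edge_weight (R : pzSemiRingType) (T : finType) (a b : T) (t : R)
  (u : T) : R := 1 + t * ((u == a)%:R + (u == b)%:R).
Arguments edge_weight {R T}.

Lemma edge_weight_ge1 (R : realDomainType) (T : finType) (a b : T) (t : R) u :
  0 <= t -> 1 <= edge_weight a b t u.
Proof. by move=> t_ge0; rewrite /edge_weight lerDl mulr_ge0 ?addr_ge0. Qed.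

Lemma sum_edge_weight (R : comPzRingType) (T : finType) (a b : T) (t : R) :
  \sum_u edge_weight a b t u = #|T|%:R + 2 * t.
Proof.
rewrite big_split /= sumr_const; congr (_ + _).
under eq_bigr do rewrite mulrDr; rewrite big_split /= !sum_indicator.
by ring.
Qed.

(** As [a != b], a square of a weight is again a weight, with parameter
    [2 t + t^2]. *)
Lemma sum_sqr_edge_weight (R : comPzRingType) (T : finType) (a b : T) (t : R) :
  a != b ->
  \sum_u edge_weight a b t u ^+ 2 = #|T|%:R + 4 * t + 2 * t ^+ 2.
Proof.
move=> ab; have sqrE u :
    edge_weight a b t u ^+ 2 = edge_weight a b (2 * t + t ^+ 2) u.
  rewrite /edge_weight; case: (eqVneq u a) => [->|_].
    by rewrite (negPf ab) /=; ring.
  by case: (u == b) => /=; ring.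
by under eq_bigr do rewrite sqrE; rewrite sum_edge_weight; ring.
Qed.

(** With [t = theta^-1] the quadratic equation reads
    [theta = n - 1 + 2 t], which is the eigenvalue equation at a vertex outside
    [{a, b}]; at [a] and [b] it becomes the same identity plus 1. *)
Lemma edge_weight_eigen (R : comPzRingType) (T : finType) (a b : T)
    (t theta : R) (v : T) :
  a != b -> theta * t = 1 -> theta ^+ 2 = (#|T|%:R - 1) * theta + 2 ->
  \sum_u edge_weight a b t u * (delete_edge_dist a b u v)%:R
    = theta * edge_weight a b t v.
Proof.
move=> ab theta_t theta2; set x := edge_weight a b t.
have distE u : x u * (delete_edge_dist a b u v)%:R = x u
    - x u * (u == v)%:R + (v == b)%:R * x u * (u == a)%:R
    + (v == a)%:R * x u * (u == b)%:R.
  rewrite /delete_edge_dist !natrD.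
  by case: (u == v); case: (u == a); case: (u == b); case: (v == a);
     case: (v == b) => /=; ring.
under eq_bigr do rewrite distE.
rewrite 3!big_split /= sumrN !sum_indicator.
rewrite (sum_edge_weight _ _ a b t : \sum_u x u = _).
have thetaE : theta = #|T|%:R - 1 + 2 * t.
  transitivity (t * theta ^+ 2); first by rewrite -[LHS]mul1r -theta_t; ring.
  rewrite theta2; transitivity ((#|T|%:R - 1) * (theta * t) + 2 * t).
    by ring.
  by rewrite theta_t mulr1.
have -> : theta * x v = theta + (theta * t) * ((v == a)%:R + (v == b)%:R).
  by rewrite /x /edge_weight; ring.
rewrite theta_t mul1r {1}thetaE /x /edge_weight !eqxx.
rewrite (negPf ab) (eq_sym b a) (negPf ab).
case: (eqVneq v a) => [->|_]; first by rewrite (negPf ab) /=; ring.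
by case: (v == b) => /=; ring.
Qed.

(** The largest distance eigenvalue of K_n - e, for [m = n - 1]. *)
Lemma quadratic_root (R : rcfType) (m : R)
    (theta := (m + Num.sqrt (m ^+ 2 + 8)) / 2) :
  0 < m -> theta ^+ 2 = m * theta + 2 /\ m < theta.
Proof.
move=> m_gt0; have := @sqr_sqrtr _ (m ^+ 2 + 8).
have : 0 <= Num.sqrt (m ^+ 2 + 8) by exact: sqrtr_ge0.
rewrite /theta; set s := Num.sqrt _ => s_ge0 /(_ _) s2.
have {}s2 : s ^+ 2 = m ^+ 2 + 8 by apply: s2; rewrite addr_ge0 ?sqr_ge0.
split; first by lra.
by nra.
Qed.

Lemma largest_eigenvalue_le_of_misses_only (R : realType) (T : finType)
    (e : rel T) (a b : T) (theta : R) :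
  simple_graph e -> connected_graph e -> a != b -> misses_only e a b ->
  theta ^+ 2 = (#|T|%:R - 1) * theta + 2 -> 0 < theta ->
  largest_eigenvalue (distance_matrix R e) <= theta.
Proof.
move=> e_simple e_conn ab eE theta2 theta_gt0.
have theta_t : theta * theta^-1 = 1 by rewrite mulfV ?gt_eqF.
have x_ge1 u : 1 <= edge_weight a b theta^-1 u.
  by apply: edge_weight_ge1; rewrite invr_ge0 ltW.
apply: (@largest_eigenvalue_le _ _ _ (edge_weight a b theta^-1)).
- exact: ltW.
- by move=> u; apply: lt_le_trans (x_ge1 u).
move=> v; rewrite -edge_weight_eigen//; apply: ler_sum => u _.
by rewrite ler_wpM2l ?ler_nat ?dist_le_of_misses_only// (le_trans _ (x_ge1 u)).
Qed.

(** * The lower bound *)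

(** Row [a] and column [a] of the form both contribute [x a] times the row
    sum; they overlap only in the diagonal entry [E a a], which vanishes, and
    every other term is nonnegative. *)
Lemma double_row_sum_le_form (R : realDomainType) (T : finType)
    (E : T -> T -> R) (x : T -> R) (a : T) :
  (forall u v, 0 <= E u v) -> (forall u v, E u v = E v u) -> E a a = 0 ->
  (forall u, 1 <= x u) ->
  2 * x a * \sum_u E u a <= \sum_v (\sum_u x u * E u v) * x v.
Proof.
move=> E_ge0 E_sym Eaa x_ge1.
have x_ge0 u : 0 <= x u by apply: le_trans (x_ge1 u).
have col_ge : \sum_u E u a <= \sum_u x u * E u a.
  by apply: ler_sum => u _; rewrite ler_peMl.
have row_ge :
    x a * \sum_u E u a <= \sum_(v | v != a) (\sum_u x u * E u v) * x v.
  rewrite [X in _ * X](bigD1 a)//= Eaa add0r mulr_sumr; apply: ler_sum => v _.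
  rewrite E_sym; apply: le_trans (ler_peMr _ (x_ge1 v)) _.
    by rewrite mulr_ge0.
  rewrite ler_wpM2r// (bigD1 a)//= lerDl.
  by apply: sumr_ge0 => u _; rewrite mulr_ge0.
rewrite [leRHS](bigD1 a)//= -mulrA mulr_natl mulr2n lerD//.
by rewrite mulrC ler_wpM2r.
Qed.

(** Lower bound on the largest distance eigenvalue by the excess of the
    transmission of [a] over its value [n] in K_n - ab. The Perron vector [x] of
    K_n - ab serves as a test vector for the actual distance matrix; the factor
    [2 x a] gained from row and column [a] exceeds
    [\sum_v x v ^+ 2 / (n - 1)], so a positive excess makes the estimate strict,
    and equality leaves no excess entry anywhere. *)
Lemma largest_eigenvalue_ge (R : realType) (T : finType) (e : rel T) (a b : T)
    (theta : R) :
  simple_graph e -> connected_graph e -> a != b -> ~~ e a b ->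
  theta ^+ 2 = (#|T|%:R - 1) * theta + 2 -> #|T|%:R - 1 < theta ->
  let d1 := largest_eigenvalue (distance_matrix R e) in
  let excess := ((transmission e a)%:R - #|T|%:R) / (#|T|%:R - 1) in
  theta + excess <= d1 /\ (d1 = theta + excess -> misses_only e a b).
Proof.
move=> e_simple e_conn ab eab theta2 theta_gt d1.
set N : R := #|T|%:R in theta2 theta_gt *; move=> r.
have [e_sym e_irr] := e_simple.
have N_ge3 : 3 <= N.
  by rewrite (ler_nat R 3); apply: card_ge3_of_nonadjacent eab.
pose t := theta^-1; have theta_gt0 : 0 < theta by lra.
have theta_t : theta * t = 1 by rewrite mulfV ?gt_eqF.
have t_gt0 : 0 < t by rewrite invr_gt0.
pose x := edge_weight a b t.
have x_ge1 u : 1 <= x u by apply: edge_weight_ge1; apply: ltW.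
pose E u v : R := (graph_dist e u v)%:R - (delete_edge_dist a b u v)%:R.
have E_ge0 u v : 0 <= E u v by rewrite subr_ge0 ler_nat delete_edge_dist_le.
have E_sym u v : E u v = E v u by rewrite /E graph_distC// delete_edge_distC.
have Eaa : E a a = 0.
  by rewrite /E graph_distxx /delete_edge_dist eqxx (negPf ab) andbF subrr.
pose X := \sum_v (\sum_u x u * E u v) * x v.
pose Q := \sum_v x v ^+ 2.
have rayleigh : theta * Q + X <= d1 * Q.
  rewrite /d1; apply: le_trans (@distance_rayleigh_le _ _ e x e_sym).
  rewrite le_eqVlt; apply/orP; left; apply/eqP.
  rewrite mulr_sumr -big_split /=; apply: eq_bigr => v _.
  rewrite expr2 mulrA -(edge_weight_eigen _ _ _ _ _ _ _ ab theta_t theta2).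
  rewrite -mulrDl -big_split /=; congr (_ * _); apply: eq_bigr => u _.
  by rewrite /E -/x; ring.
have QE : Q = N + 4 * t + 2 * t ^+ 2 by rewrite /Q sum_sqr_edge_weight.
have colE : \sum_u E u a = r * (N - 1).
  rewrite /r divfK; last by rewrite gt_eqF//; lra.
  by rewrite sumrB sum_delete_edge_dist// -natr_sum.
have X_ge : 2 * (1 + t) * (r * (N - 1)) <= X.
  rewrite -colE.
  apply: le_trans (double_row_sum_le_form _ _ _ _ _ E_ge0 E_sym Eaa x_ge1).
  by rewrite /x /edge_weight eqxx (negPf ab) addr0 mulr1.
have r_ge0 : 0 <= r.
  have : 0 <= r * (N - 1) by rewrite -colE sumr_ge0.
  by rewrite pmulr_lge0//; lra.
(* As [2 <= n - 1 < theta], [t] is at most 1/2, and the two sides of [gap]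
   differ by at least [1 - 2 * t ^+ 2]. *)
have t_small : t * 2 <= 1 by rewrite -theta_t mulrC ler_pM2r//; lra.
have gap : Q < 2 * (1 + t) * (N - 1) by rewrite QE; nra.
have Q_gt0 : 0 < Q by rewrite QE; nra.
split; first by rewrite -(ler_pM2r Q_gt0); nra.
move=> d1E; rewrite d1E in rayleigh.
have X_le0 : X <= 0.
  have r_le0 : r <= 0 by nra.
  have r0 : r = 0 by lra.
  by rewrite r0 in rayleigh; lra.
have term_ge0 u v : 0 <= x u * E u v.
  by rewrite mulr_ge0// (le_trans _ (x_ge1 u)).
have x_gt0 u : 0 < x u by apply: lt_le_trans (x_ge1 u).
apply: misses_only_of_dist => // u v; apply/eqP; rewrite -(eqr_nat R) -subr_eq0.
rewrite -/(E u v) eq_le E_ge0 andbT.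
rewrite -(pmulr_rle0 _ (x_gt0 u)) -(pmulr_lle0 _ (x_gt0 v)).
(* [x u * E u v * x v] is one of the nonnegative terms of [X <= 0]. *)
apply: le_trans X_le0; rewrite /X (bigD1 v)//= (bigD1 u)//=.
rewrite [Y in _ <= Y + _]mulrDl -addrA lerDl.
rewrite addr_ge0 ?mulr_ge0 ?sumr_ge0// => [|w _]; first exact: ltW.
by rewrite mulr_ge0 ?sumr_ge0// ltW.
Qed.

Theorem theorem3p6 (R : realType) (T : finType) (e : rel T) (n : nat)
    (e_simple : simple_graph e) (e_conn : connected_graph e)
    (card_T : #|T| = n)
    (e_not_complete : ~ graph_iso e (@complete_graph n)) :
  let d1 := largest_eigenvalue (distance_matrix R e) in
  let rho := remoteness R e in
  let bound : R :=
    (n%:R - 1 + Num.sqrt ((n%:R - 1) ^+ 2 + 8)) / 2 - n%:R / (n%:R - 1) in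
  bound <= d1 - rho /\
  (d1 - rho = bound <->
   exists a b : 'I_n, a != b /\
     graph_iso e (delete_edge (@complete_graph n) a b)).
Proof.
move=> d1 rho; set theta : R := (_ + Num.sqrt _) / 2; move=> bound.
have [e_sym e_irr] := e_simple.
have [a0 [b0 [ab0 eab0]]] :=
  exists_nonadjacent _ _ _ e_irr card_T e_not_complete.
have [a a_max rhoE] := @remotenessE R T e a0.
(* A vertex adjacent to all others would have transmission [#|T| - 1]. *)
have [b ab eab] : exists2 b, a != b & ~~ e a b.
  have Tr_a : (#|T| <= transmission e a)%N.
    by apply: leq_trans (a_max a0); apply: card_le_transmission eab0.
  apply/exists2P; apply/not_existsP => adj_a; move: Tr_a; rewrite leqNgt.
  rewrite transmission_lt_card// => u ua; rewrite e_sym.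
  by apply/negPn/negP => eau; apply: (adj_a u); rewrite eq_sym.
have n_ge3 : 3 <= n%:R :> R.
  by rewrite (ler_nat R 3) -card_T; apply: card_ge3_of_nonadjacent eab0.
have [theta2 theta_gt] :
    theta ^+ 2 = (n%:R - 1) * theta + 2 /\ n%:R - 1 < theta.
  by apply: quadratic_root; lra.
rewrite -card_T in theta2 theta_gt.
have [] :=
  largest_eigenvalue_ge _ _ _ _ _ _ e_simple e_conn ab eab theta2 theta_gt.
rewrite -/d1 mulrBl -rhoE -/rho card_T => d1_ge d1_eq.
have bound_le : bound <= d1 - rho by rewrite /bound; lra.
split=> //; rewrite iso_delete_edge_completeP//.
split=> [d1E|[a1 [b1 [ab1 eE]]]].
  by exists a, b; split=> //; apply: d1_eq; rewrite /bound in d1E; lra.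
apply/le_anti; rewrite bound_le andbT; apply: lerB.
  apply: largest_eigenvalue_le_of_misses_only eE _ _ => //.
  by rewrite card_T in theta_gt; lra.
rewrite /rho rhoE -card_T ler_wpM2r ?invr_ge0 ?ler_nat//.
  by rewrite card_T; lra.
apply: leq_trans (a_max a1); apply: card_le_transmission ab1 _ => //.
by rewrite eE !eqxx andbF.
Qed.
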